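(* There is a polynomial-time algorithm that, given a co-tree $G$, computes the b-chromatic number $\chi_b(G)$.
   Context: Graphs are finite and simple. A co-tree is a graph whose complement is a tree. A b-coloring of a graph with $t$ colors is a proper coloring of the vertices with $t$ colors such that every color class contains a vertex that is adjacent to all other $t-1$ color classes. The b-chromatic number $\chi_b(G)$ is the maximum $t$ such that $G$ admits a b-coloring with $t$ colors. *)

(* Defs.v *)
From mathcomp Require Import all_boot all_algebra.

Set Implicit Arguments.
Unset Strict Implicit.
Unset Printing Implicit Defensive.

Record sgraph (V : finType) := SGraph {
  adj :> rel V;
  adj_sym : symmetric adj;
  adj_irrefl : irreflexive adj
}.

Definition compl_adj (V : finType) (G : sgraph V) : rel V :=
  [rel x y | (x != y) && ~~ G x y].

Fact compl_sym (V : finType) (G : sgraph V) : symmetric (compl_adj G).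
Proof. by move=> x y; rewrite /compl_adj /= eq_sym adj_sym. Qed.

Fact compl_irrefl (V : finType) (G : sgraph V) : irreflexive (compl_adj G).
Proof. by move=> x; rewrite /compl_adj /= eqxx. Qed.

Definition compl (V : finType) (G : sgraph V) : sgraph V :=
  SGraph (compl_sym G) (compl_irrefl G).

Definition connected (V : finType) (G : sgraph V) : Prop :=
  0 < #|V| /\ forall x y : V, connect G x y.

(* [ucycle G c] also holds for the empty sequence and for the two ends of an
   edge; the cycles of a simple graph have length at least 3. *)
Definition acyclic (V : finType) (G : sgraph V) : Prop :=
  forall c : seq V, 2 < size c -> ~ ucycle G c.

Definition is_tree (V : finType) (G : sgraph V) : Prop :=
  connected G /\ acyclic G.

Definition is_cotree (V : finType) (G : sgraph V) : Prop :=
  is_tree (compl G).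

Definition proper_coloring (V : finType) (G : sgraph V) (t : nat)
    (f : {ffun V -> 'I_t}) : bool :=
  [forall x, forall y, G x y ==> (f x != f y)].

Definition b_coloring (V : finType) (G : sgraph V) (t : nat)
    (f : {ffun V -> 'I_t}) : bool :=
  proper_coloring G f &&
  [forall c, exists x, (f x == c) &&
     [forall d, (d != c) ==> [exists y, G x y && (f y == d)]]].

Definition b_colorable (V : finType) (G : sgraph V) (t : nat) : bool :=
  [exists f : {ffun V -> 'I_t}, b_coloring G f].

(* The range of the maximum loses nothing: the colors of a b-coloring are all
   used, see [leq_chi_b]. *)
Definition chi_b (V : finType) (G : sgraph V) : nat :=
  \max_(t < #|V|.+1 | b_colorable G t) t.

Lemma b_colorable_leq (V : finType) (G : sgraph V) (t : nat) :
  b_colorable G t -> t <= #|V|.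
Proof.
case/existsP=> f /andP[_ /forallP fb].
have fsurj c : exists x, f x == c.
  by case/existsP: (fb c) => x /andP[fx _]; exists x.
have ginj : injective (fun c => xchoose (fsurj c)).
  move=> c d /= cd.
  by rewrite -(eqP (xchooseP (fsurj c))) cd (eqP (xchooseP (fsurj d))).
by have := leq_card _ ginj; rewrite card_ord.
Qed.

Lemma leq_chi_b (V : finType) (G : sgraph V) (t : nat) :
  b_colorable G t -> t <= chi_b G.
Proof.
move=> Gt; have tV : t < #|V|.+1 by rewrite ltnS (b_colorable_leq Gt).
exact: (@leq_bigmax_cond _ _ (fun s : 'I_ #|V|.+1 => s : nat) (Ordinal tV)).
Qed.

Lemma b_colorable_ex (V : finType) (G : sgraph V) : exists t, b_colorable G t.
Proof.
have ex : exists t, [exists f : {ffun V -> 'I_t}, proper_coloring G f].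
  exists #|V|; apply/existsP; exists [ffun x => enum_rank x].
  apply/forallP=> x; apply/forallP=> y; apply/implyP=> Gxy; rewrite !ffunE.
  by apply: contraTneq Gxy => /enum_rank_inj ->; rewrite adj_irrefl.
case: (ex_minnP ex) => t /existsP[f fP] tmin; exists t.
apply/existsP; exists f; apply/andP; split=> //.
apply/forallP=> c; apply: contraT; rewrite negb_exists => /forallP nb.
case: t f fP tmin c nb => [|t] f fP tmin c nb; first by case: (c).
have miss x : {d | f x = c -> d != c /\ forall y, G x y -> f y != d}.
  case: (f x =P c) => [fx|//]; last by exists c.
  have := nb x; rewrite fx eqxx /= negb_forall => /existsP/sigW[d].
  rewrite negb_imply negb_exists => /andP[dc /forallP dP].
  by exists d => _; split=> // y Gxy; have := dP y; rewrite Gxy.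
pose g x := if f x == c then sval (miss x) else f x.
have gc x : c != g x.
  rewrite eq_sym /g; case: (f x =P c) => [/(svalP (miss x))[]//|/eqP //].
have gP x y : G x y -> g x != g y.
  move=> Gxy; have fxy : f x != f y.
    by move/forallP: fP => /(_ x)/forallP/(_ y); rewrite Gxy.
  rewrite /g; case: (f x =P c) => [fx|_]; case: (f y =P c) => [fy|_] //.
  - by rewrite fx fy eqxx in fxy.
  - by rewrite eq_sym; have [_ ->] := svalP (miss x) fx.
  - by have [_ ->] := svalP (miss y) fy; rewrite // adj_sym.
pose h := [ffun x => s2val (unlift_some (gc x))].
have hP x : g x = lift c (h x) by rewrite ffunE; case: unlift_some.
suff /tmin: [exists f : {ffun V -> 'I_t}, proper_coloring G f] by rewrite ltnn.
apply/existsP; exists h; apply/forallP=> x; apply/forallP=> y; apply/implyP=> /gP.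
by rewrite !hP (inj_eq lift_inj).
Qed.

Lemma chi_b_colorable (V : finType) (G : sgraph V) : b_colorable G (chi_b G).
Proof.
have [t Gt] := b_colorable_ex G.
have tV : t < #|V|.+1 by rewrite ltnS (b_colorable_leq Gt).
have [|s Gs maxE] :=
    @eq_bigmax_cond _ [pred s : 'I_ #|V|.+1 | b_colorable G s] val.
  by apply/card_gt0P; exists (Ordinal tV).
have -> : chi_b G = s by rewrite -[RHS]maxE; apply: eq_bigl.
exact: Gs.
Qed.

(* Random access machine with unit cost: finitely many registers (those named
   in the program) and an unbounded memory, both holding natural numbers.  The
   only arithmetic is addition and truncated subtraction, so a number has at
   most linearly many bits in the running time plus the size of the input; thus
   polynomial time is the same as on a Turing machine.  Multiplication at unit
   cost would break this. *)
Inductive expr : Type :=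
| Const of nat
| Reg of nat
| Read of expr
| Add of expr & expr
| Sub of expr & expr.

Inductive cmd : Type :=
| Skip
| Assign of nat & expr
| Store of expr & expr
| Seq of cmd & cmd
| If of expr & cmd & cmd
| While of expr & cmd.

Record state := State { reg : nat -> nat; mem : nat -> nat }.

Definition upd (f : nat -> nat) (a v : nat) : nat -> nat :=
  fun b => if b == a then v else f b.

Fixpoint eval (s : state) (e : expr) : nat :=
  match e with
  | Const n => n
  | Reg x => reg s x
  | Read e1 => mem s (eval s e1)
  | Add e1 e2 => eval s e1 + eval s e2
  | Sub e1 e2 => eval s e1 - eval s e2
  end.

Fixpoint cost (e : expr) : nat :=
  match e with
  | Const _ | Reg _ => 1
  | Read e1 => (cost e1).+1
  | Add e1 e2 | Sub e1 e2 => (cost e1 + cost e2).+1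
  end.

(* [exec c s t s']: started in state [s], the program [c] halts in state [s']
   after exactly [t] steps.  A test succeeds when its value is nonzero. *)
Inductive exec : cmd -> state -> nat -> state -> Prop :=
| ExecSkip s :
    exec Skip s 1 s
| ExecAssign x e s :
    exec (Assign x e) s (cost e).+1 (State (upd (reg s) x (eval s e)) (mem s))
| ExecStore a e s :
    exec (Store a e) s (cost a + cost e).+1
         (State (reg s) (upd (mem s) (eval s a) (eval s e)))
| ExecSeq c1 c2 s1 s2 s3 t1 t2 :
    exec c1 s1 t1 s2 -> exec c2 s2 t2 s3 ->
    exec (Seq c1 c2) s1 (t1 + t2) s3
| ExecIfTrue e c1 c2 s s' t :
    eval s e != 0 -> exec c1 s t s' ->
    exec (If e c1 c2) s (cost e + t).+1 s'
| ExecIfFalse e c1 c2 s s' t :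
    eval s e == 0 -> exec c2 s t s' ->
    exec (If e c1 c2) s (cost e + t).+1 s'
| ExecWhileTrue e c s1 s2 s3 t1 t2 :
    eval s1 e != 0 -> exec c s1 t1 s2 -> exec (While e c) s2 t2 s3 ->
    exec (While e c) s1 (cost e + t1 + t2).+1 s3
| ExecWhileFalse e c s :
    eval s e == 0 ->
    exec (While e c) s (cost e).+1 s.

Lemma exec_det (c : cmd) (s s1 s2 : state) (t1 t2 : nat) :
  exec c s t1 s1 -> exec c s t2 s2 -> t1 = t2 /\ s1 = s2.
Proof.
move=> ex; elim: ex t2 s2 => {c s s1 t1}.
- by move=> s t2 s2 ex; inversion ex; subst.
- by move=> x e s t2 s2 ex; inversion ex; subst.
- by move=> a e s t2 s2 ex; inversion ex; subst.
- move=> c1 c2 s1 s2 s3 t1 t2 _ IH1 _ IH2 t s ex; inversion ex; subst.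
  case: (IH1 _ _ ltac:(eassumption)) => ? ?; subst.
  by case: (IH2 _ _ ltac:(eassumption)) => -> ->.
- move=> e c1 c2 s s' t e0 _ IH t2 s2 ex; inversion ex; subst.
    by case: (IH _ _ ltac:(eassumption)) => -> ->.
  by case/negP: e0.
- move=> e c1 c2 s s' t e0 _ IH t2 s2 ex; inversion ex as [| | | |? ? ? ? ? ? e1| | |]; subst.
    by case/negP: e1.
  by case: (IH _ _ ltac:(eassumption)) => -> ->.
- move=> e c s1 s2 s3 t1 t2 e0 _ IH1 _ IH2 t s ex; inversion ex; subst.
    case: (IH1 _ _ ltac:(eassumption)) => ? ?; subst.
    by case: (IH2 _ _ ltac:(eassumption)) => -> ->.
  by case/negP: e0.
- move=> e c s e0 t2 s2 ex.
  inversion ex as [| | | | | |? ? ? ? ? ? ? e1|]; subst=> //.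
  by case/negP: e1.
Qed.

(* The input is the number n of vertices, in register 0, and the n x n
   adjacency matrix, stored row by row from address 0; everything else is 0. *)
Definition input (n : nat) (G : sgraph 'I_n) : state :=
  State (upd (fun _ => 0) 0 n)
        (fun a => [exists i, exists j, G i j && (a == i * n + j)]).

(* The output is read in register 0. The input has size of order n ^ 2, so
   that a polynomial in n is the same as a polynomial in the size of the
   input. *)
Definition polytime_computes
    (P : forall n : nat, sgraph 'I_n -> Prop)
    (F : forall n : nat, sgraph 'I_n -> nat) (c : cmd) : Prop :=
  exists p : {poly nat}, forall (n : nat) (G : sgraph 'I_n), P n G ->
    exists (t : nat) (s : state),
      [/\ exec c (input G) t s, t <= p.[n]%R & reg s 0 = F n G].

(* Main.v *)
Require Import Defs.
From mathcomp Require Import all_boot all_algebra zify.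

(* Write T for the complement of G.  A b-coloring of G with t colors partitions
   the vertices into cliques of the forest T, that is, into single vertices and
   edges of a matching of size n - t.  Call Key the b-vertex of a class of size
   two and Mate its other vertex: the coloring is a b-coloring exactly when all
   T-neighbors of a Single vertex are Mates.  Hence n - chi_b(G) is the least
   number of Mates in such a labelling, an optimization problem on a forest.
   It is solved by eliminating vertices of degree at most 1 one after the other,
   each leaf being folded into the cost table of its neighbor; the table has an
   entry for every label, with or without a partner among the vertices already
   eliminated.  Every step preserves the optimum, whatever the order. *)

Set Implicit Arguments.
Unset Strict Implicit.
Unset Printing Implicit Defensive.

(** * Labels of the vertices *)

(* The flag of [Key] and [Mate] tells that the partner has been eliminated. *)
Inductive role := Single | Key of bool | Mate of bool.

Definition pending (x : role) : bool :=
  match x with Key false | Mate false => true | _ => false end.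

Definition is_mate (x : role) : bool :=
  match x with Mate _ => true | _ => false end.

Definition opposite (x : role) : role :=
  match x with Single => Single | Key b => Mate b | Mate b => Key b end.

Definition settle (x : role) : role :=
  match x with Single => Single | Key _ => Key true | Mate _ => Mate true end.

(** The edge constraint of [plan], for both orientations of the edge. *)
Definition compatible (x y : role) : Prop :=
  (x = Single -> is_mate y) /\ (y = Single -> is_mate x).

Definition set_at (V : eqType) (A : Type) (f : V -> A) (v : V) (a : A) : V -> A :=
  fun w => if w == v then a else f w.

Lemma set_at_eq (V : eqType) (A : Type) (f : V -> A) v a : set_at f v a v = a.
Proof. by rewrite /set_at eqxx. Qed.

Lemma set_at_neq (V : eqType) (A : Type) (f : V -> A) v a w :
  w != v -> set_at f v a w = f w.
Proof. by rewrite /set_at => /negPf->. Qed.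

(** * Plans on a vertex set and the elimination of vertices of degree at most 1 *)

Section Elimination.
Variables (V : finType) (T : sgraph V).
Implicit Types (S : {set V}) (st : V -> role) (m : V -> V) (u v w : V).
Implicit Types (tab : role -> V -> nat).

(** Only a pending vertex needs a partner, so [m] is arbitrary elsewhere. When T is the complement
    forest of G, it has no triangles, so every vertex has a G-neighbor in each class of size two
    other than its own. Only a class with one vertex can be missed, by a Single or by a Key, and the
    second clause excludes both. *)
Definition plan S st m : Prop :=
  (forall v, v \in S -> pending (st v) ->
     [/\ m v \in S, T v (m v), st (m v) = opposite (st v) & m (m v) = v]) /\
  (forall u v, u \in S -> v \in S -> T u v -> st u = Single -> is_mate (st v)).

(** The optimum is described by its upper bounds [k], which avoids a minimum over plans; [acc] is
    the cost of the components already eliminated. *)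
Definition attainable S tab (acc k : nat) : Prop :=
  exists st m, plan S st m /\ \sum_(v in S) tab (st v) v + acc <= k.

(* [settled_cost] and [closed_cost] are the cheapest ways to eliminate [v] without
   matching it to a remaining vertex, next to a [Key] and a [Mate] respectively. *)
Definition settled_cost tab v :=
  minn (tab (Key true) v) (tab (Mate true) v).

Definition closed_cost tab v :=
  minn (settled_cost tab v) (tab Single v).

(** The cheapest total for [u] labelled [x] together with [v]. The flag [true] on [u] arises in two
    ways: it was there before, or [v] is the partner of [u]; hence the two minima. A Single [u]
    forces a settled Mate at [v], and only next to a Mate may [v] be Single. *)
Definition fold_cost tab v u (x : role) : nat :=
  match x with
  | Single => tab Single u + tab (Mate true) v
  | Key false => tab (Key false) u + settled_cost tab v
  | Key true => minn (tab (Key true) u + settled_cost tab v)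
                     (tab (Key false) u + tab (Mate false) v)
  | Mate false => tab (Mate false) u + closed_cost tab v
  | Mate true => minn (tab (Mate true) u + closed_cost tab v)
                      (tab (Mate false) u + tab (Key false) v)
  end.

Definition fold_table tab v u : role -> V -> nat :=
  fun x w => if w == u then fold_cost tab v u x else tab x w.

Lemma adj_neq u v : T u v -> u != v.
Proof. by apply: contraTneq => ->; rewrite adj_irrefl. Qed.

Lemma pending_opposite x : pending (opposite x) = pending x.
Proof. by case: x => // -[]. Qed.

(** A vertex that is not pending is nobody's partner, because partners carry opposite labels and
    these are pending together. *)
Lemma plan_restrict S st m v :
  plan S st m -> v \in S -> ~~ pending (st v) -> plan (S :\ v) st m.
Proof.
move=> [pm ps] vS npv; split.
  move=> w; rewrite in_setD1 => /andP[wv wS] pw.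
  have [mS Tm om mm] := pm w wS pw; split=> //.
  rewrite in_setD1 mS andbT; apply: contraNneq npv => <-.
  by rewrite om pending_opposite.
by move=> a b; rewrite !in_setD1 => /andP[_ aS] /andP[_ bS]; apply: ps.
Qed.

(** The partner of [v] stays behind with the settled version of its label; whether it is a Mate does
    not change, so the edge constraints survive. *)
Lemma plan_restrict_pending S st m v :
  plan S st m -> v \in S -> pending (st v) ->
  plan (S :\ v) (set_at st (m v) (settle (st (m v)))) m.
Proof.
move=> [pm ps] vS pv; have [mS Tm om mm] := pm v vS pv; split.
  move=> w; rewrite in_setD1 /set_at => /andP[wv wS].
  case: eqP => [->|/eqP wm] pw.
    by case: (st (m v)) pw => // -[].
  have [mwS Tmw omw mmw] := pm w wS pw.
  have mwmv : m w != m v by apply: contraNneq wv => E; rewrite -mmw E mm.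
  rewrite (negPf mwmv); split=> //; rewrite in_setD1 mwS andbT.
  by apply: contraNneq wm => <-; rewrite mmw.
move=> a b; rewrite !in_setD1 /set_at => /andP[_ aS] /andP[_ bS] Tab.
have key : is_mate (settle (st (m v))) = is_mate (st (m v)).
  by case: (st (m v)).
case: (a =P m v) => [am|_] sa.
  by move: sa; rewrite om; case: (st v) pv.
by have := ps _ _ aS bS Tab sa; case: eqP => [->|//]; rewrite key.
Qed.

Lemma plan_extend S st m v y :
  plan (S :\ v) st m -> v \in S -> ~~ pending y ->
  (forall u, u \in S -> T v u -> compatible (st u) y) ->
  plan S (set_at st v y) m.
Proof.
move=> [pm ps] vS npy cy; split.
  move=> w wS; rewrite /set_at; case: eqP => [_|/eqP wv]; first by rewrite (negPf npy).
  move=> pw; have [|mS Tm om mm] := pm w _ pw; first by rewrite in_setD1 wv.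
  by move: mS; rewrite in_setD1 => /andP[/negPf-> mS]; split.
move=> a b aS bS Tab; rewrite /set_at.
case: (a =P v) => [av|/eqP av]; case: (b =P v) => [bv|/eqP bv].
- by move: Tab; rewrite av bv adj_irrefl.
- by rewrite av in Tab => E; have [_ /(_ E)] := cy _ bS Tab.
- by rewrite bv adj_sym in Tab => E; have [/(_ E)] := cy _ aS Tab.
- by apply: ps; rewrite ?in_setD1 ?av ?bv.
Qed.

(** Undoes [plan_restrict_pending] at a leaf: the settled label of [u] becomes pending again, now
    with partner [v]. The only edge at [v] leads to [u], and neither end is Single. *)
Lemma plan_extend_pending S st m v u y :
  plan (S :\ v) st m -> v \in S -> u \in S -> T v u ->
  (forall w, w \in S -> T v w -> w = u) ->
  pending y -> st u = settle (opposite y) ->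
  plan S (set_at (set_at st u (opposite y)) v y) (set_at (set_at m u v) v u).
Proof.
move=> [pm ps] vS uS Tvu leaf py su.
have uv : u != v by rewrite eq_sym adj_neq.
have npu : ~~ pending (st u) by rewrite su; case: (y) => [|[]|[]].
have oppK : opposite (opposite y) = y by case: (y) => [|[]|[]].
split.
  move=> w wS; rewrite /set_at; case: (w =P v) => [->|/eqP wv].
    by rewrite (negPf uv) eqxx.
  case: (w =P u) => [->|/eqP wu].
    by rewrite !eqxx oppK adj_sym.
  move=> pw; have [|mS Tm om mm] := pm w _ pw; first by rewrite in_setD1 wv.
  move: mS; rewrite in_setD1 => /andP[/negPf-> mS].
  case: (m w =P u) => [E|_]; last by [].
  by case/negP: npu; rewrite -E om pending_opposite.
have ny : y <> Single by move: py; case: (y).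
have no : opposite y <> Single by move: py; case: (y).
move=> a b aS bS Tab; rewrite /set_at.
case: (a =P v) => [av /ny|/eqP av] //; case: (b =P v) => [bv|/eqP bv].
  by rewrite bv adj_sym in Tab; rewrite (leaf _ aS Tab) eqxx => /no.
case: (a =P u) => [au /no|/eqP au] // sa.
have : is_mate (st b) by apply: (ps a b); rewrite // ?in_setD1 ?av ?bv.
by case: eqP => // ->; rewrite su; case: (y).
Qed.

(** Without an edge inside [S], the vertex [v] cannot be pending, and any other label suits it. *)
Lemma attainable_isolated S tab acc k v :
  v \in S -> (forall w, w \in S -> ~~ T v w) ->
  attainable S tab acc k <->
  attainable (S :\ v) tab (acc + closed_cost tab v) k.
Proof.
move=> vS iso; split=> -[st [m [pl le]]].
  have npv : ~~ pending (st v).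
    by apply/negP=> /(pl.1 v vS)[mS Tm _ _]; have := iso _ mS; rewrite Tm.
  exists st, m; split; first exact: plan_restrict.
  move: le; rewrite (big_setD1 v vS) /=.
  suff : closed_cost tab v <= tab (st v) v by lia.
  by rewrite /closed_cost /settled_cost; case: (st v) npv => [|[]|[]] // _; lia.
have [y npy ey] : exists2 y, ~~ pending y & tab y v = closed_cost tab v.
  rewrite /closed_cost /settled_cost /minn.
  case: ifP => _; last by exists Single.
  by case: ifP => _; [exists (Key true) | exists (Mate true)].
exists (set_at st v y), m; split.
  by apply: plan_extend => // u /iso/negPf->.
rewrite (big_setD1 v vS) /= set_at_eq ey.
rewrite (eq_bigr (fun w => tab (st w) w)); first lia.
by move=> w; rewrite in_setD1 /set_at => /andP[/negPf->].
Qed.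

(** A plan on [S] restricts to one on [S :\ v], where [u] gets a settled label if it was matched
    with [v]. Conversely, the argument at which the minima in [fold_cost] are reached tells how to
    label [v]. *)
Lemma attainable_leaf S tab acc k v u :
  v \in S -> u \in S -> T v u -> (forall w, w \in S -> T v w -> w = u) ->
  attainable S tab acc k <->
  attainable (S :\ v) (fold_table tab v u) acc k.
Proof.
move=> vS uS Tvu leaf.
have uv : u != v by rewrite eq_sym adj_neq.
have uSv : u \in S :\ v by rewrite in_setD1 uv.
split=> -[st [m [pl le]]].
  move: le; rewrite (big_setD1 v vS) (big_setD1 u uSv) /= => le.
  have rest x : \sum_(w in S :\ v :\ u) fold_table tab v u (set_at st u x w) w
              = \sum_(w in S :\ v :\ u) tab (st w) w.
    apply: eq_bigr => w; rewrite !in_setD1 => /andP[/negPf wu _].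
    by rewrite /fold_table /set_at wu.
  have [pv|npv] := boolP (pending (st v)).
    have [mS Tm om mm] := pl.1 v vS pv; have mu := leaf _ mS Tm.
    exists (set_at st u (settle (st u))), m; split.
      by rewrite -mu; apply: plan_restrict_pending.
    rewrite (big_setD1 u uSv) rest /= /fold_table /set_at !eqxx.
    rewrite mu in om; move: le; rewrite om.
    by case: (st v) pv => [|[]|[]] //= _; lia.
  (* A vacuous update, which gives the sum the shape of [rest]. *)
  exists (set_at st u (st u)), m; split.
    have [pm ps] := plan_restrict pl vS npv.
    have E w : set_at st u (st u) w = st w by rewrite /set_at; case: eqP => // ->.
    by split=> [w|a b]; rewrite !E; [apply: pm|apply: ps].
  rewrite (big_setD1 u uSv) rest /= /fold_table /set_at !eqxx.
  have := pl.2 _ _ uS vS; rewrite adj_sym => /(_ Tvu).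
  have := pl.2 _ _ vS uS Tvu.
  move: le; rewrite /fold_cost /closed_cost /settled_cost.
  case: (st v) npv => [|[]|[]] //= _; case: (st u) => [|[]|[]] //= le;
    by [ lia | move=> /(_ erefl) | move=> _ /(_ erefl) ].
move: le; rewrite (big_setD1 u uSv) /= {1}/fold_table eqxx.
rewrite (eq_bigr (fun w => tab (st w) w)); last first.
  by move=> w; rewrite !in_setD1 /fold_table => /andP[/negPf->].
set rest := \sum_(w in S :\ v :\ u) tab (st w) w => le.
(* [keep] adds [v] without matching it to [u]; [join] makes the two partners. *)
have keep y : ~~ pending y -> compatible (st u) y ->
    tab (st u) u + tab y v <= fold_cost tab v u (st u) ->
    attainable S tab acc k.
  move=> npy cy ley; exists (set_at st v y), m; split.
    by apply: plan_extend => // w wS /(leaf w wS) ->.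
  rewrite (big_setD1 v vS) (big_setD1 u uSv) /= set_at_eq set_at_neq //.
  rewrite (eq_bigr (fun w => tab (st w) w)) -/rest; first lia.
  by move=> w; rewrite !in_setD1 /set_at => /and3P[_ /negPf->].
have join y : pending y -> st u = settle (opposite y) ->
    tab (opposite y) u + tab y v <= fold_cost tab v u (st u) ->
    attainable S tab acc k.
  move=> py suy ley.
  exists (set_at (set_at st u (opposite y)) v y), (set_at (set_at m u v) v u).
  split; first exact: plan_extend_pending.
  rewrite (big_setD1 v vS) (big_setD1 u uSv) /= set_at_eq set_at_neq // set_at_eq.
  rewrite (eq_bigr (fun w => tab (st w) w)) -/rest; first lia.
  by move=> w; rewrite !in_setD1 /set_at => /and3P[/negPf-> /negPf->].
have settled : tab (st u) u + settled_cost tab v <= fold_cost tab v u (st u) ->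
    st u <> Single -> attainable S tab acc k.
  rewrite /settled_cost /minn; case: ifP => _ ley nu.
    by apply: (keep (Key true)) => //; split.
  by apply: (keep (Mate true)) => //; split.
have closed : tab (st u) u + closed_cost tab v <= fold_cost tab v u (st u) ->
    is_mate (st u) -> attainable S tab acc k.
  rewrite /closed_cost {1}/minn; case: ifP => _ ley mu.
    by apply: settled => // E; rewrite E in mu.
  by apply: (keep Single) => //; split=> // E; rewrite E in mu.
case su: (st u) keep join settled closed => [|[]|[]] /= keep join settled closed.
- by apply: (keep (Mate true)) => //; split.
- have [le1|/ltnW le1] := leqP (tab (Key true) u + settled_cost tab v)
                       (tab (Key false) u + tab (Mate false) v).
    by apply: settled => //; rewrite leq_min leqnn.
  by apply: (join (Mate false)) => //=; rewrite leq_min leqnn andbT.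
- by apply: settled.
- have [le1|/ltnW le1] := leqP (tab (Mate true) u + closed_cost tab v)
                       (tab (Mate false) u + tab (Key false) v).
    by apply: closed => //; rewrite leq_min leqnn.
  by apply: (join (Key false)) => //=; rewrite leq_min leqnn andbT.
- by apply: closed.
Qed.

Lemma attainable_set0 tab acc k : attainable set0 tab acc k <-> acc <= k.
Proof.
split=> [[st [m [_]]]|le]; first by rewrite big_set0.
exists (fun _ => Single), id; rewrite big_set0; split=> //.
by split=> [v|u v]; rewrite in_set0.
Qed.

(** * Vertices of degree at most 1 in a forest *)

Definition nbrs S v : {set V} := [set w in S | T v w].

(** If all degrees within [S] were at least 2, a path in [S] could always be prolonged at its first
    vertex, since a further neighbor lying on the path would close a cycle. Paths would then outgrow
    [V]. *)
Lemma acyclic_low_degree S :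
  acyclic T -> S != set0 -> exists2 v, v \in S & #|nbrs S v| <= 1.
Proof.
move=> acT /set0Pn[x0 x0S].
have [/exists_inP[v vS dv]|] := boolP [exists v in S, #|nbrs S v| <= 1].
  by exists v.
rewrite negb_exists_in => /forall_inP deg.
have two v y : v \in S -> exists2 z, z \in S & T v z && (z != y).
  move=> vS; have := deg v vS; rewrite -ltnNge (cardsD1 y) => lt2.
  have /set0Pn[z] : nbrs S v :\ y != set0.
    by rewrite -card_gt0; case: (_ \in _) lt2; lia.
  by rewrite !inE => /andP[zy /andP[zS Tz]]; exists z => //; rewrite Tz.
suff long k : exists x y p, [/\ path T x (y :: p), uniq [:: x, y & p],
    all (mem S) [:: x, y & p] & size p = k].
  have [x [y [p [_ up _ sp]]]] := long #|V|.
  have := max_card (mem [:: x, y & p]); rewrite (card_uniqP up) /= sp.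
  by rewrite ltnNge leqnSn.
elim: k => [|k [x [y [p [Tp up Sp <-]]]]].
  have [z zS /andP[Tz zx]] := two x0 x0 x0S.
  by exists x0, z, [::]; rewrite /= !inE Tz x0S zS eq_sym zx.
have /= /andP[xS _] := Sp.
have [z zS /andP[Txz zy]] := two x y xS.
have [zp|zp] := boolP (z \in [:: x, y & p]); last first.
  exists z, x, (y :: p); rewrite [all _ _]/= in Sp *; split=> //=.
  - by rewrite adj_sym Txz.
  - by rewrite zp.
  - by apply/andP.
have zx : z != x by rewrite eq_sym adj_neq.
move: zp; rewrite !inE (negPf zx) (negPf zy) /= => zp.
case/splitPr: zp Tp up Sp => p1 p2 Tp up _.
(* Since [z] differs from [y], the part of the path from [x] to [z] closes into a cycle of length at
   least 3. *)
case: (acT [:: x, y & rcons p1 z]); first by rewrite /= size_rcons.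
apply/andP; split.
  rewrite /= rcons_path last_rcons [T z x]adj_sym Txz andbT.
  move: Tp => /= /andP[-> ]; rewrite cat_path /= rcons_path.
  by case/and3P=> -> -> _.
move: up; rewrite -cat_rcons -cat_cons -cat_cons cat_uniq => /andP[] //.
Qed.

Lemma acyclic_triangle x y z : acyclic T -> T x y -> T y z -> ~~ T x z.
Proof.
move=> acT Txy Tyz; apply/negP=> Txz; case: (acT [:: x; y; z]) => //.
rewrite /ucycle /= Txy Tyz [T z x]adj_sym Txz !inE !negb_or.
by rewrite !adj_neq.
Qed.

End Elimination.

(** * b-colorings of G as plans on its complement *)

(* No partner has been eliminated at the start; an infinite cost is not needed,
   since at most #|V| vertices are Mates. *)
Definition start_table (V : finType) (x : role) (_ : V) : nat :=
  match x with
  | Single | Key false => 0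
  | Mate false => 1
  | Key true | Mate true => #|V|.+1
  end.

Section BColoring.
Variables (V : finType) (G : sgraph V).
Hypothesis acG : acyclic (compl G).

(** The colors are the fixed points of the idempotent map [r]; each serves as the b-vertex of its
    own class. *)
Lemma b_colorable_representatives (r : V -> V) :
  (forall v, r (r v) = r v) ->
  (forall x y, G x y -> r x != r y) ->
  (forall x y, r x = x -> r y = y -> x != y -> exists2 z, G x z & r z = y) ->
  b_colorable G #|[set v | r v == v]|.
Proof.
move=> rr rP rb; set K := [set v | r v == v].
have rK v : r v \in K by rewrite inE rr.
pose f := [ffun v => enum_rank_in (rK v) (r v)].
have fK v : enum_val (f v) = r v by rewrite ffunE enum_rankK_in.
apply/existsP; exists f; apply/andP; split.
  apply/forallP=> x; apply/forallP=> y; apply/implyP=> /rP.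
  by apply: contra_neq => E; rewrite -!fK E.
have Kr (c : 'I_#|K|) : r (enum_val c) = enum_val c.
  have : enum_val c \in K by apply: enum_valP.
  by rewrite inE => /eqP.
apply/forallP=> c; apply/existsP; exists (enum_val c); apply/andP; split.
  by apply/eqP/enum_val_inj; rewrite fK.
apply/forallP=> d; apply/implyP=> dc; apply/existsP.
have ne : enum_val c != enum_val d.
  by apply: contra_neq dc => /enum_val_inj.
have [z Gz rz] := rb _ _ (Kr c) (Kr d) ne.
by exists z; rewrite Gz; apply/eqP/enum_val_inj; rewrite fK.
Qed.

(** Sending each Mate to its Key and fixing all other vertices yields the representatives; the
    vertices lost are the Mates, at most [k] in number. *)
Lemma attainable_b_colorable k :
  k <= #|V| -> attainable (compl G) setT (@start_table V) 0 k ->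
  exists2 t, #|V| - k <= t & b_colorable G t.
Proof.
move=> kV [st [m [[pm ps] le]]]; rewrite addn0 in le.
(* A single flagged label would already cost [#|V|.+1], which exceeds [k]. *)
have small v : st v <> Key true /\ st v <> Mate true.
  have : start_table (st v) v <= k.
    by apply: leq_trans le; rewrite (bigD1 v) ?inE //= leq_addr.
  case: (st v) => [|[]|[]] /= le1; try by split.
    by have := leq_trans le1 kV; rewrite ltnn.
  by have := leq_trans le1 kV; rewrite ltnn.
have mate v : is_mate (st v) -> [/\ compl G v (m v), st (m v) = Key false & m (m v) = v].
  move=> mv; have sv : st v = Mate false.
    by have [_] := small v; case: (st v) mv => [|[]|[]].
  have [|_ ? om ?] := pm v (in_setT v); first by rewrite sv.
  by rewrite sv in om.
pose r v := if is_mate (st v) then m v else v.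
have rE v : (r v == v) = ~~ is_mate (st v).
  rewrite /r; case: ifP => [/mate[cv _ _]|]; last by rewrite eqxx.
  by rewrite eq_sym (negPf (adj_neq cv)).
exists #|[set v | r v == v]|; last first.
  apply: b_colorable_representatives => [v|x y Gxy|x y /eqP + /eqP + xy].
  - rewrite {2 3}/r; case: ifP => [/mate[_ sm _]|nv]; last by rewrite /r nv.
    by rewrite /r sm.
  - have xy : x != y by apply: adj_neq Gxy.
    have nT : ~~ compl G x y by rewrite /= /compl_adj /= xy Gxy.
    rewrite /r; case: ifP => [/mate[Tx _ mx]|_]; case: ifP => [/mate[Ty _ my]|_] //.
    + by apply: contra_neq xy => E; rewrite -mx E my.
    + by apply: contraNneq nT => <-.
    + by apply: contraNneq nT => ->; rewrite adj_sym.
  - rewrite !rE => nx ny.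
    have [Gxy|nGxy] := boolP (G x y); first by exists y; rewrite // /r (negPf ny).
    have Txy : compl G x y by rewrite /= /compl_adj /= xy.
    (* A Single [y] would have only Mates as T-neighbors, and [x] is none. So [y] is a Key, and for
       want of triangles its Mate is adjacent to [x] in G. *)
    have sy : pending (st y).
      have := ps y x (in_setT y) (in_setT x); rewrite adj_sym => /(_ Txy).
      have [] := small y; case: (st y) ny => [|[]|[]] //= _ _ _ /(_ erefl).
      by rewrite (negPf nx).
    have [_ Tym om mm] := pm y (in_setT y) sy.
    have mz : is_mate (st (m y)) by rewrite om; case: (st y) ny sy.
    exists (m y); last by rewrite /r mz.
    have := acyclic_triangle acG Txy Tym.
    rewrite /= /compl_adj /= negb_and !negbK => /orP[/eqP E|//].
    by rewrite E mz in nx.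
have -> : [set v | r v == v] = ~: [set v | is_mate (st v)].
  by apply/setP=> v; rewrite !inE rE.
rewrite cardsCs setCK leq_sub2l //; apply: leq_trans le.
rewrite -sum1_card [leqLHS]big_mkcond /= [leqRHS]big_mkcond leq_sum // => v _.
by rewrite !inE; case: (st v) => [|[]|[]].
Qed.

(** Fix a b-vertex in each color: it becomes a Key or a Single according to whether its class has
    another vertex, and the [#|V| - t] remaining vertices become Mates. *)
Lemma b_colorable_attainable t :
  b_colorable G t -> attainable (compl G) setT (@start_table V) 0 (#|V| - t).
Proof.
case/existsP=> f /andP[/forallP fP /forallP fb].
have {}fP x y : x != y -> f x = f y -> compl G x y.
  move=> xy E; rewrite /= /compl_adj /= xy; apply/negP=> Gxy.
  by have := fP x => /forallP/(_ y); rewrite Gxy E eqxx.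
pose b c := xchoose (existsP (fb c)).
have bP c : f (b c) = c /\
    forall d, d != c -> exists2 y, G (b c) y & f y = d.
  have /andP[/eqP-> /forallP bd] := xchooseP (existsP (fb c)); split=> // d dc.
  by have := bd d; rewrite dc => /existsP[y /andP[? /eqP]]; exists y.
(* A class is a clique of the forest, so it has at most two vertices. *)
have three x y z : f x = f y -> f x = f z -> x != y -> x != z -> y = z.
  move=> fy fz xy xz; apply/eqP; apply: contraT => yz.
  have Tyz : compl G y z by apply: fP; rewrite // -fy.
  by have := acyclic_triangle acG (fP _ _ xy fy) Tyz; rewrite fP.
pose other v := [pick w | (w != v) && (f w == f v)].
pose st v := if v != b (f v) then Mate false else
             if other v is Some _ then Key false else Single.
pose m v := if v != b (f v) then b (f v) else odflt v (other v).
exists st, m; rewrite addn0; split; last first.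
  have -> : \sum_(v in [set: V]) start_table (st v) v
          = #|[set v | v != b (f v)]|.
    rewrite -sum1_card big_mkcond [RHS]big_mkcond; apply: eq_bigr => v _.
    by rewrite !inE /st; case: ifP => // _; case: (other v).
  have -> : [set v | v != b (f v)] = ~: (b @: setT).
    apply/setP=> v; rewrite !inE; congr (~~ _); apply/eqP/imsetP=> [->|[c _ ->]].
      by exists (f v).
    by rewrite (bP c).1.
  rewrite cardsCs setCK card_imset ?cardsT ?card_ord //.
  by move=> c d E; rewrite -(bP c).1 E (bP d).1.
split=> [v _|u v _ _ Tuv].
  rewrite /st /m; case: ifP => [vb _|/negbFE/eqP vb].
    have [fbv _] := bP (f v); rewrite fbv eqxx /= inE /other.
    split=> //; first by apply: fP; rewrite // fbv.
      by case: pickP => // /(_ v); rewrite vb fbv eqxx.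
    case: pickP => [w /andP[wb /eqP fw]|/(_ v)]; last by rewrite vb fbv eqxx.
    by apply: (three (b (f v))); rewrite // eq_sym.
  rewrite /other; case: pickP => [w /andP[wv /eqP fw] _|//] /=.
  rewrite fw -vb wv inE; split=> //.
  by apply: (fP v w); rewrite // eq_sym.
(* Here [u] is alone in its class. If [v] were the b-vertex of its own class, it would see the color
   of [u], hence be adjacent to [u] in G. *)
rewrite /st; case: ifP => // _; case E: (other u) => [w|] // _.
case: ifP => // /negbFE/eqP vb.
have only y : f y = f u -> y = u.
  move=> fy; apply/eqP; apply: contraT => yu.
  by move: E; rewrite /other; case: pickP => // /(_ y); rewrite yu fy eqxx.
have [|y] := (bP (f v)).2 (f u).
  by apply: contraTneq Tuv => /esym/only ->; rewrite adj_irrefl.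
rewrite -vb => Gvy /only yu; move: Tuv; rewrite adj_sym /= /compl_adj /=.
by rewrite -yu Gvy andbF.
Qed.

(** The hypothesis makes [acc] the optimum. A b-coloring with [chi_b G] colors bounds it from above,
    and a plan of cost [acc] gives at least [#|V| - acc] colors. *)
Lemma chi_b_attainable acc :
  (forall k, attainable (compl G) setT (@start_table V) 0 k <-> acc <= k) ->
  chi_b G = #|V| - acc.
Proof.
move=> accP; have le : acc <= #|V| - chi_b G.
  by apply/accP/b_colorable_attainable/chi_b_colorable.
have [||t le2 /leq_chi_b] := @attainable_b_colorable acc.
- by apply: leq_trans le (leq_subr _ _).
- exact/accP.
have := b_colorable_leq (chi_b_colorable G).
by lia.
Qed.

End BColoring.

(** * Correctness triples with time bounds for the machine *)

(* MathComp's [mem] and [Sub] hide those of the machine. *)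
Local Notation memory := Defs.mem.
Local Notation Minus := Defs.Sub.

(** Total correctness within time [b], in the shape of a weakest precondition: the tail of a
    sequence goes into [Q], so that a program is proved by running it symbolically. *)
Definition runs (c : cmd) (s : state) (b : nat) (Q : state -> Prop) : Prop :=
  exists t s', [/\ exec c s t s', t <= b & Q s'].

Definition set_reg (s : state) (x v : nat) : state :=
  State (upd (reg s) x v) (memory s).

Lemma runs_weaken c s b b' (Q Q' : state -> Prop) :
  runs c s b Q -> b <= b' -> (forall s', Q s' -> Q' s') -> runs c s b' Q'.
Proof.
move=> [t [s' [ex tb Qs]]] bb QQ; exists t, s'; split=> //; last exact: QQ.
exact: leq_trans bb.
Qed.

Lemma runs_le c s b b' Q : runs c s b Q -> b <= b' -> runs c s b' Q.
Proof. by move=> r le; apply: runs_weaken r le _. Qed.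

Lemma runs_skip s (Q : state -> Prop) : Q s -> runs Skip s 1 Q.
Proof. by exists 1, s; split=> //; constructor. Qed.

Lemma runs_assign x e s (Q : state -> Prop) :
  Q (set_reg s x (eval s e)) -> runs (Assign x e) s (cost e).+1 Q.
Proof. by exists (cost e).+1; eexists; split; [constructor | |]. Qed.

Lemma runs_assign_eq x e s a (Q : state -> Prop) :
  eval s e = a -> Q (set_reg s x a) -> runs (Assign x e) s (cost e).+1 Q.
Proof. by move=> <-; apply: runs_assign. Qed.

Lemma runs_store a e s (Q : state -> Prop) :
  Q (State (reg s) (upd (memory s) (eval s a) (eval s e))) ->
  runs (Store a e) s (cost a + cost e).+1 Q.
Proof. by exists (cost a + cost e).+1; eexists; split; [constructor | |]. Qed.

Lemma runs_seq c1 c2 s b1 b2 Q :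
  runs c1 s b1 (fun s1 => runs c2 s1 b2 Q) -> runs (Seq c1 c2) s (b1 + b2) Q.
Proof.
move=> [t1 [s1 [ex1 le1 [t2 [s2 [ex2 le2 Qs]]]]]].
exists (t1 + t2), s2; split=> //; first exact: ExecSeq ex2.
exact: leq_add.
Qed.

(** Serves to spend a given budget command by command. *)
Lemma runs_seq_le c1 c2 s b b1 Q :
  b1 <= b -> runs c1 s b1 (fun s1 => runs c2 s1 (b - b1) Q) ->
  runs (Seq c1 c2) s b Q.
Proof. by move=> le r; rewrite -(subnKC le); apply: runs_seq. Qed.

Lemma runs_if e c1 c2 s b1 b2 Q :
  (eval s e != 0 -> runs c1 s b1 Q) -> (eval s e = 0 -> runs c2 s b2 Q) ->
  runs (If e c1 c2) s (cost e + (b1 + b2)).+1 Q.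
Proof.
move=> r1 r2; have [e0|e0] := eqVneq (eval s e) 0.
  have [t [s' [ex le Qs]]] := r2 e0; exists (cost e + t).+1, s'; split=> //.
    by apply: ExecIfFalse => //; rewrite e0.
  by rewrite ltnS leq_add2l (leq_trans le) ?leq_addl.
have [t [s' [ex le Qs]]] := r1 e0; exists (cost e + t).+1, s'; split=> //.
  exact: ExecIfTrue.
by rewrite ltnS leq_add2l (leq_trans le) ?leq_addr.
Qed.

(** The upper limit is register 0, which holds n during all loops; [x] is not initialized here. *)
Definition For (x : nat) (body : cmd) : cmd :=
  While (Minus (Reg 0) (Reg x)) (Seq body (Assign x (Add (Reg x) (Const 1)))).

(** Besides the body, a turn costs 4 steps for the test and 4 for the increment; the failing test
    costs the last 4. *)
Lemma runs_for x body n b (I : nat -> state -> Prop) s :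
  (forall i s, I i s -> reg s 0 = n /\ reg s x = i) ->
  (forall i s, i < n -> I i s ->
     runs body s b (fun s' => reg s' x = i /\ I i.+1 (set_reg s' x i.+1))) ->
  I 0 s -> runs (For x body) s (n * (b + 8) + 4) (I n).
Proof.
move=> Ireg Istep I0; rewrite -{1}[n]subn0.
suff loop d i s' : d = n - i -> i <= n -> I i s' ->
    runs (For x body) s' (d * (b + 8) + 4) (I n) by exact: loop.
elim: d i s' => [|d IHd] i s' di le_in Ii; have [r0 rx] := Ireg _ _ Ii.
  have ein : i = n by lia.
  exists 4, s'; split; rewrite ?ein in Ii * => //.
  by apply: (ExecWhileFalse (e := Minus (Reg 0) (Reg x))); rewrite /= r0 rx ein subnn.
have lt_in : i < n by lia.
have [t1 [s1 [ex1 le1 [rx1 I1]]]] := Istep _ _ lt_in Ii.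
have [|//|t2 [s2 [ex2 le2 I2]]] := IHd _ _ _ _ I1; first lia.
exists (3 + (t1 + 4) + t2).+1, s2; split=> //; last by rewrite mulSn; lia.
apply: (ExecWhileTrue (e := Minus (Reg 0) (Reg x))) ex2.
  by rewrite /= r0 rx subn_eq0 -ltnNge.
apply: ExecSeq ex1 _.
have -> : set_reg s1 x i.+1 =
    set_reg s1 x (eval s1 (Add (Reg x) (Const 1))) by rewrite /= rx1 addn1.
exact: ExecAssign.
Qed.

(** * The elimination algorithm as a machine program *)

(* Row i < n of the memory (the addresses i * n + v with v < n) is the input.  Row
   n marks the eliminated vertices and row n + table_row x is the table of role x.
   Register j + 1 holds the address of row n + j for j < 6. *)
Definition table_row (x : role) : nat :=
  match x with
  | Single => 1 | Key false => 2 | Key true => 3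
  | Mate false => 4 | Mate true => 5
  end.

Definition cell (j v : nat) : expr := Read (Add (Reg j.+1) (Reg v)).

Definition table_cell (x : role) (v : nat) : expr := cell (table_row x) v.

Definition set_table_cell (x : role) (v : nat) (e : expr) : cmd :=
  Store (Add (Reg (table_row x).+1) (Reg v)) e.

Definition Min (a b : expr) : expr := Minus a (Minus a b).

Fixpoint block (cs : seq cmd) : cmd :=
  if cs is c :: cs' then Seq c (block cs') else Skip.

(* Registers: 7 counts the rounds, 8 is the vertex v under consideration and 9 the
   address of its input row, 10 runs over the possible neighbors w, 11 and 12 are
   the number of neighbors of v found and the last of them, 13 accumulates the cost
   of the eliminated components, and the others are scratch. *)

(* Nonzero exactly when w is a remaining vertex, is not v and is not adjacent to v
   in G. *)
Definition linked : expr :=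
  Minus (Const 1)
    (Add (Read (Add (Reg 9) (Reg 10)))
         (Add (cell 0 10)
              (Minus (Const 1) (Add (Minus (Reg 8) (Reg 10))
                                    (Minus (Reg 10) (Reg 8)))))).

Definition scan : cmd :=
  For 10
    (If linked
        (Seq (Assign 11 (Add (Reg 11) (Const 1))) (Assign 12 (Reg 10)))
        Skip).

Definition roles : seq role := [:: Single; Key false; Key true; Mate false; Mate true].

Definition fold_expr (x : role) : expr :=
  match x with
  | Single => Add (table_cell Single 12) (table_cell (Mate true) 8)
  | Key false => Add (table_cell (Key false) 12) (Reg 14)
  | Key true => Min (Add (table_cell (Key true) 12) (Reg 14))
                    (Add (table_cell (Key false) 12) (table_cell (Mate false) 8))
  | Mate false => Add (table_cell (Mate false) 12) (Reg 15)
  | Mate true => Min (Add (table_cell (Mate true) 12) (Reg 15))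
                     (Add (table_cell (Mate false) 12) (table_cell (Key false) 8))
  end.

(** All five entries are computed into registers 16 to 20 before any is written back, since they
    depend on the old entries of [u]. *)
Definition fold_cells : cmd :=
  block ([seq Assign (table_row x + 15) (fold_expr x) | x <- roles] ++
         [seq set_table_cell x 12 (Reg (table_row x + 15)) | x <- roles]).

(** Registers 14 and 15 receive [settled_cost] and [closed_cost] of the vertex; register 11, its
    degree, decides between a leaf and an isolated vertex. *)
Definition eliminate : cmd :=
  block
    [:: Store (Add (Reg 1) (Reg 8)) (Const 1);
        Assign 14 (Min (table_cell (Key true) 8) (table_cell (Mate true) 8));
        Assign 15 (Min (Reg 14) (table_cell Single 8));
        If (Reg 11) fold_cells (Assign 13 (Add (Reg 13) (Reg 15)))].

Definition visit : cmd :=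
  If (cell 0 8) Skip
     (block [:: Assign 10 (Const 0); Assign 11 (Const 0); scan;
                If (Minus (Reg 11) (Const 1)) Skip eliminate]).

Definition round : cmd :=
  block [:: Assign 8 (Const 0); Assign 9 (Const 0);
            For 8 (Seq visit (Assign 9 (Add (Reg 9) (Reg 0))))].

(** The address n * n of row n has to be formed by repeated addition. *)
Definition square : cmd := For 7 (Assign 1 (Add (Reg 1) (Reg 0))).

Definition rows : cmd :=
  block [seq Assign j.+2 (Add (Reg j.+1) (Reg 0)) | j <- iota 0 5].

(** Memory outside the matrix is initially 0, so only the nonzero entries of [start_table] are
    written. *)
Definition start_cells : cmd :=
  For 8 (block [:: set_table_cell (Key true) 8 (Add (Reg 0) (Const 1));
                   set_table_cell (Mate false) 8 (Const 1);
                   set_table_cell (Mate true) 8 (Add (Reg 0) (Const 1))]).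

Definition cotree_chi_b : cmd :=
  block [:: square; rows; Assign 8 (Const 0); start_cells;
            Assign 7 (Const 0); For 7 round;
            Assign 0 (Minus (Reg 0) (Reg 13))].

(** * Correctness and running time of the program *)

Section Correctness.
Variables (n : nat) (G : sgraph 'I_n).
Local Notation T := (compl G).
Implicit Types (S : {set 'I_n}) (tab : role -> 'I_n -> nat) (v w u : 'I_n).

Lemma addr_eq i j v w : (i * n + v == j * n + w) = (i == j) && (v == w).
Proof.
apply/eqP/andP=> [E|[/eqP-> /eqP->]] //.
have n0 : 0 < n by apply: leq_ltn_trans (ltn_ord v).
have := congr1 (modn^~ n) E; rewrite /= !modnMDl !modn_small // => vw.
have := congr1 (divn^~ n) E; rewrite /= !divnMDl // !divn_small // !addn0 => ->.
by split=> //; apply/eqP/val_inj.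
Qed.

Definition represents S tab acc (s : state) : Prop :=
  [/\ reg s 0 = n, forall j, j < 6 -> reg s j.+1 = (n + j) * n & reg s 13 = acc] /\
  [/\ forall v w, memory s (v * n + w) = G v w,
      forall v, memory s ((n + 0) * n + v) = (v \notin S) &
      forall x v, memory s ((n + table_row x) * n + v) = tab x v].

Lemma represents_ext S tab acc s s' :
  represents S tab acc s -> memory s' = memory s ->
  (forall j, j < 7 \/ j = 13 -> reg s' j = reg s j) -> represents S tab acc s'.
Proof.
move=> [[r0 rj ra] mP] E R; split; last by rewrite E.
by split=> [|j j6|]; rewrite R; auto.
Qed.

(** The loop invariant of [scan], with [i] the next candidate; register 12 is meaningful only once a
    neighbor has been found. *)
Definition scanned S v i (s s' : state) : Prop :=
  let N := [set w in nbrs T S v | w < i] in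
  [/\ memory s' = memory s,
      forall j, j \notin [:: 10; 11; 12] -> reg s' j = reg s j,
      reg s' 10 = i, reg s' 11 = #|N| &
      0 < #|N| -> exists2 w, w \in N & reg s' 12 = w].

Lemma scan_runs S tab acc v s :
  represents S tab acc s -> reg s 8 = v -> reg s 9 = v * n ->
  reg s 10 = 0 -> reg s 11 = 0 ->
  runs scan s (n * 40 + 4) (scanned S v n s).
Proof.
move=> [[r0 rj ra] [mG mS mt]] r8 r9 r10 r11.
apply: (@runs_le _ _ (n * (32 + 8) + 4)) => //.
apply: (@runs_for _ _ n 32 (fun i => scanned S v i s)).
- by move=> i s' [_ /(_ 0)-> // -> _ _].
- move=> i s' lt_in [E R R10 R11 R12]; pose w := Ordinal lt_in.
  have cond : eval s' linked = (w \in nbrs T S v).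
    rewrite /= R10 E !R // r9 r8 rj // (mG v w) (mS w).
    rewrite inE /= /compl_adj /=; have [->|vw] := eqVneq v w.
      by rewrite andbF /=; lia.
    have : (v : nat) <> w by move/val_inj/eqP; rewrite (negPf vw).
    by case: (w \in S); case: (G v w) => /=; lia.
  apply: (@runs_le _ _ (cost linked + (4 + 2 + 1)).+1) => //.
  have split_i : [set w in nbrs T S v | w < i.+1] =
      if w \in nbrs T S v then w |: [set w in nbrs T S v | w < i]
      else [set w in nbrs T S v | w < i].
    apply/setP=> z; have ltz : (z < i.+1) = (z == w) || (z < i).
      by rewrite ltnS leq_eqVlt.
    case: ifP => wN; rewrite !inE ltz; case: eqP => //= ->.
      by rewrite inE in wN; rewrite wN.
    by rewrite inE in wN; rewrite wN.
  have new : w \notin [set w in nbrs T S v | w < i] by rewrite !inE ltnn andbF.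
  apply: runs_if; rewrite cond; case: ifP split_i => // wN split_i _.
    apply: runs_seq; apply: runs_assign; apply: runs_assign.
    split; rewrite /set_reg /upd //=; split=> //=.
    +
      by move=> j jN; rewrite (R j jN); move: jN; rewrite !inE !negb_or;
        case/and3P=> [/negPf-> /negPf-> /negPf->].
    + by rewrite R11 split_i cardsU1 new addn1.
    + by rewrite split_i => _; exists w; rewrite ?R10 // setU11.
  apply: runs_skip; split=> //; split; rewrite /set_reg /upd //= ?split_i //.
  by move=> j jN; rewrite (R j jN); move: jN; rewrite !inE !negb_or => /and3P[/negPf-> _ _].
- have N0 : [set w in nbrs T S v | w < 0] = set0 by apply/setP=> w; rewrite !inE andbF.
  by split; rewrite // N0 cards0.
Qed.

Lemma represents_set_reg S tab acc s x a :
  represents S tab acc s -> 6 < x -> x != 13 ->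
  represents S tab acc (set_reg s x a).
Proof.
move=> rep x6 x13; apply: represents_ext rep _ _ => // j.
by rewrite /set_reg /upd /= => jx; case: eqP => // E; lia.
Qed.

Lemma represents_kill S tab acc s v :
  represents S tab acc s ->
  represents (S :\ v) tab acc
    (State (reg s) (upd (memory s) ((n + 0) * n + v) 1)).
Proof.
move=> [regs [mG mS mt]]; split=> //; rewrite /upd; split=> [a b|w|x w] /=.
- by rewrite addr_eq mG addn0 ltn_eqF.
- by rewrite addr_eq eqxx mS in_setD1; case: (w == v).
- by rewrite addr_eq mt eqn_add2l; case: x => [|[]|[]].
Qed.

(** [table_row] is injective, so comparing rows amounts to comparing roles. *)
Definition set_table tab x u a : role -> 'I_n -> nat :=
  fun y w => if (table_row y == table_row x) && (w == u) then a else tab y w.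

Lemma represents_set_table S tab acc s x u a :
  represents S tab acc s ->
  represents S (set_table tab x u a) acc
    (State (reg s) (upd (memory s) ((n + table_row x) * n + u) a)).
Proof.
move=> [regs [mG mS mt]]; split=> //; rewrite /upd; split=> [b c|w|y w] /=.
- by rewrite addr_eq mG ltn_eqF // (leq_trans (ltn_ord b)) ?leq_addr.
- by rewrite addr_eq mS eqn_add2l; case: x => [|[]|[]].
- by rewrite addr_eq mt eqn_add2l.
Qed.

Lemma represents_table S tab tab' acc s :
  represents S tab acc s -> (forall x w, tab x w = tab' x w) ->
  represents S tab' acc s.
Proof. by move=> [regs [mG mS mt]] E; split=> //; split=> // x w; rewrite mt. Qed.

Lemma eval_add s a b : eval s (Add a b) = eval s a + eval s b.
Proof. by []. Qed.

Lemma eval_min s a b : eval s (Min a b) = minn (eval s a) (eval s b).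
Proof. by rewrite minnE. Qed.

Lemma eval_table_cell S tab acc s v r x :
  represents S tab acc s -> reg s r = v -> eval s (table_cell x r) = tab x v.
Proof.
move=> [[_ rj _] [_ _ mt]] rv; rewrite /= rj ?rv ?mt //.
by case: x => [|[]|[]].
Qed.

Lemma set_table_cell_runs S tab acc s x v r e (Q : state -> Prop) :
  represents S tab acc s -> reg s r = v ->
  (forall s', represents S (set_table tab x v (eval s e)) acc s' ->
     reg s' = reg s -> Q s') ->
  runs (set_table_cell x r e) s (cost e + 4) Q.
Proof.
move=> rep rv QP; have [[_ rj _] _] := rep; rewrite addnC.
apply: (@runs_store (Add (Reg (table_row x).+1) (Reg r)) e); apply: QP => //=.
rewrite rj ?rv; last by case: x => [|[]|[]].
exact: represents_set_table.
Qed.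

(** Registers 7 to 9 drive the loops over rounds and vertices, hence must survive a visit. *)
Definition frame (s s' : state) : Prop :=
  forall j, 6 < j < 10 -> reg s' j = reg s j.

Lemma frame_set_reg s s' x a :
  frame s s' -> ~~ (6 < x < 10) -> frame s (set_reg s' x a).
Proof.
move=> fr xN j jj; rewrite -fr // /set_reg /upd /=.
by case: eqP => // jx; rewrite -jx jj in xN.
Qed.

Lemma frame_trans s s' s'' : frame s s' -> frame s' s'' -> frame s s''.
Proof. by move=> fr fr' j jj; rewrite fr' // fr. Qed.

Lemma fold_runs S tab acc v u s :
  represents S tab acc s -> reg s 8 = v -> reg s 12 = u ->
  reg s 14 = settled_cost tab v -> reg s 15 = closed_cost tab v ->
  runs fold_cells s 310 (fun s' => represents S (fold_table tab v u) acc s' /\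
    frame s s').
Proof.
move=> rep r8 r12 r14 r15.
(* The evaluations write only registers from 16 on, so all five see the same operands. *)
pose ctx s' := represents S tab acc s' /\ forall j, j < 16 -> reg s' j = reg s j.
have eval_fold s' x : ctx s' -> eval s' (fold_expr x) = fold_cost tab v u x.
  move=> [rep' fr].
  have c8 y : eval s' (table_cell y 8) = tab y v.
    by apply: eval_table_cell rep' _; rewrite fr.
  have c12 y : eval s' (table_cell y 12) = tab y u.
    by apply: eval_table_cell rep' _; rewrite fr.
  have e14 : eval s' (Reg 14) = settled_cost tab v by rewrite -r14 -fr.
  have e15 : eval s' (Reg 15) = closed_cost tab v by rewrite -r15 -fr.
  by case: x => [|[]|[]]; rewrite /fold_expr ?eval_min !eval_add ?c8 ?c12 ?e14 ?e15.
have ctx_set s' x a : ctx s' -> ctx (set_reg s' (table_row x + 15) a).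
  move=> [rep' fr]; split; last first.
    by move=> j j16; rewrite -fr //= /upd; case: eqP => // E; case: x E => [|[]|[]] /=; lia.
  by apply: represents_set_reg rep' _ _; case: x => [|[]|[]].
have compute s' x c b Q : ctx s' -> 30 <= b ->
    runs c (set_reg s' (table_row x + 15) (fold_cost tab v u x)) (b - 30) Q ->
    runs (Seq (Assign (table_row x + 15) (fold_expr x)) c) s' b Q.
  move=> cs' b30 r; apply: (@runs_seq_le _ _ _ _ 30) => //.
  apply: (@runs_le _ _ (cost (fold_expr x)).+1); last by case: (x) => [|[]|[]].
  by apply: runs_assign_eq r; apply: eval_fold.
pose load s' x := set_reg s' (table_row x + 15) (fold_cost tab v u x).
pose s5 := foldl load s roles.
have s5E x : reg s5 (table_row x + 15) = fold_cost tab v u x by case: x => [|[]|[]].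
have ctx5 : ctx s5 by do 5!apply: (ctx_set).
have write tab' s' x c b Q : represents S tab' acc s' -> reg s' = reg s5 ->
    30 <= b ->
    (forall s'', represents S (set_table tab' x u (fold_cost tab v u x)) acc s'' ->
       reg s'' = reg s5 -> runs c s'' (b - 30) Q) ->
    runs (Seq (set_table_cell x 12 (Reg (table_row x + 15))) c) s' b Q.
  move=> rep' E b30 r; apply: (@runs_seq_le _ _ _ _ 30) => //.
  apply: (@runs_le _ _ 5) => //.
  have r12' : reg s' 12 = u by rewrite E ctx5.2.
  apply: set_table_cell_runs rep' r12' _ => s'' rep'' E''.
  by apply: r; [rewrite -s5E -E | rewrite E''].
do 5!(apply: (compute); [by repeat apply: (ctx_set) | by [] | ]).
apply: (write tab) => [|||s1 rep1 E1]; rewrite //; first exact: ctx5.1.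
apply: (write _ _ _ _ _ _ rep1 E1) => // s2 rep2 E2.
apply: (write _ _ _ _ _ _ rep2 E2) => // s3 rep3 E3.
apply: (write _ _ _ _ _ _ rep3 E3) => // s4 rep4 E4.
apply: (write _ _ _ _ _ _ rep4 E4) => // s6 rep6 E6.
apply: (@runs_le _ _ 1) => //; apply: runs_skip; split.
  (* The five updates at [u], one for each role, amount to [fold_table]. *)
  apply: represents_table rep6 _ => x w; rewrite /set_table /fold_table.
  by case: (w == u); case: x => [|[]|[]].
by move=> j /andP[_ j10]; rewrite E6 ctx5.2 //; lia.
Qed.

(** The new table is existential: later steps need only that the remaining problem has the same
    attainable values. *)
Definition reduces S tab acc S' (s s' : state) : Prop :=
  frame s s' /\ exists tab' acc', represents S' tab' acc' s' /\
    forall k, attainable T S tab acc k <-> attainable T S' tab' acc' k.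

Lemma eliminate_runs S tab acc v s :
  represents S tab acc s -> v \in S -> #|nbrs T S v| <= 1 -> reg s 8 = v ->
  reg s 11 = #|nbrs T S v| ->
  (0 < #|nbrs T S v| -> exists2 u, u \in nbrs T S v & reg s 12 = u) ->
  runs eliminate s 400 (reduces S tab acc (S :\ v) s).
Proof.
move=> rep vS le1 r8 r11 r12; have [[_ rj _] _] := rep.
apply: (@runs_seq_le _ _ _ _ 5) => //.
apply: (@runs_store (Add (Reg 1) (Reg 8)) (Const 1)).
rewrite [eval s _]/= rj // r8; set s1 := State _ _.
have rep1 : represents (S :\ v) tab acc s1 by apply: represents_kill.
apply: (@runs_seq_le _ _ _ _ 20) => //; apply: (@runs_le _ _ 15) => //.
apply: (@runs_assign_eq _ _ _ (settled_cost tab v)).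
  by rewrite eval_min !(eval_table_cell (v := v) _ rep1).
set s2 := set_reg s1 _ _.
have rep2 : represents (S :\ v) tab acc s2 by apply: represents_set_reg.
apply: (@runs_seq_le _ _ _ _ 20) => //; apply: (@runs_le _ _ 9) => //.
apply: (@runs_assign_eq _ _ _ (closed_cost tab v)).
  by rewrite eval_min !(eval_table_cell (v := v) _ rep2).
set s3 := set_reg s2 _ _.
have rep3 : represents (S :\ v) tab acc s3 by apply: represents_set_reg.
apply: (@runs_seq_le _ _ _ _ 330) => //.
apply: (@runs_le _ _ (cost (Reg 11) + (310 + 4)).+1) => //.
apply: runs_if => /= r11'.
  have {r12}[|u uN r12] := r12; first by rewrite lt0n -r11.
  apply: runs_weaken (fold_runs rep3 r8 r12 erefl erefl) _ _ => // s' [rep' fr].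
  apply: (@runs_le _ _ 1) => //; apply: runs_skip; split.
    by apply: frame_trans fr; do 2!(apply: frame_set_reg => //).
  exists (fold_table tab v u), acc; split=> // k.
  move: uN; rewrite inE => /andP[uS Tvu].
  apply: attainable_leaf => // w wS Tvw; apply/(card_le1_eqP le1); by rewrite inE ?uS ?wS.
apply: (@runs_assign_eq _ _ _ (acc + closed_cost tab v)).
  by have [[_ _ <-] _] := rep3.
set s4 := set_reg s3 _ _.
apply: (@runs_le _ _ 1) => //; apply: runs_skip; split.
  by do 3!(apply: frame_set_reg => //).
exists tab, (acc + closed_cost tab v); split.
  have [[r0 rj3 ra] mP] := rep3; split=> //.
  split=> // j j6; rewrite -rj3 // /s4 /set_reg /upd /=.
  by case: eqP => // E; lia.
move=> k; apply: attainable_isolated => // w wS; apply/negP=> Tvw.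
have : w \in nbrs T S v by rewrite inE wS.
have /eqP : #|nbrs T S v| = 0 by rewrite -r11; apply: r11'.
by rewrite cards_eq0 => /eqP->; rewrite inE.
Qed.

Definition low_degree S v := #|nbrs T S v| <= 1.

Definition prune S v : {set 'I_n} :=
  if (v \in S) && low_degree S v then S :\ v else S.

Lemma visit_runs S tab acc v s :
  represents S tab acc s -> reg s 8 = v -> reg s 9 = v * n ->
  runs visit s (n * 40 + 500) (reduces S tab acc (prune S v) s).
Proof.
move=> rep r8 r9; have [[_ rj _] [_ mS _]] := rep.
apply: (@runs_le _ _ (cost (cell 0 8) + (1 + (n * 40 + 450))).+1); last first.
  by rewrite /=; lia.
have refl s' : represents S tab acc s' -> frame s s' -> reduces S tab acc S s s'.
  by move=> rep' fr; split=> //; exists tab, acc.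
apply: runs_if; rewrite /= rj // r8 mS => vS.
  by apply: runs_skip; rewrite /prune; case: (v \in S) vS => // _; apply: refl.
have {}vS : v \in S by case: (v \in S) vS.
apply: (@runs_seq_le _ _ _ _ 2); first lia; apply: runs_assign.
apply: (@runs_seq_le _ _ _ _ 2); first lia; apply: runs_assign.
set s1 := set_reg _ _ _.
have rep1 : represents S tab acc s1 by do 2!apply: represents_set_reg => //.
apply: (@runs_seq_le _ _ _ _ (n * 40 + 4)); first lia.
apply: runs_weaken (scan_runs rep1 r8 r9 erefl erefl) _ _ => // s2 [E R _].
have -> : [set w in nbrs T S v | w < n] = nbrs T S v.
  by apply/setP=> w; rewrite inE ltn_ord andbT.
move=> r11 r12.
have fr2 : frame s s2.
  have fr1 : frame s s1 by do 2!(apply: frame_set_reg => //).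
  by move=> j jj; rewrite R ?fr1 // !inE; lia.
have rep2 : represents S tab acc s2.
  by apply: represents_ext rep1 E _ => j jj; apply: R; rewrite !inE; lia.
apply: (@runs_le _ _ ((cost (Minus (Reg 11) (Const 1)) + (1 + 400)).+1 + 1)); last first.
  by rewrite /=; lia.
apply: runs_seq; apply: runs_if; rewrite /= r11 => deg.
  apply: runs_skip; apply: runs_skip; rewrite /prune /low_degree vS leqNgt -subn_gt0 lt0n deg.
  exact: refl.
have low : #|nbrs T S v| <= 1 by rewrite -subn_eq0 deg.
apply: runs_weaken (eliminate_runs rep2 vS low _ r11 r12) _ _ => //.
  by rewrite fr2.
move=> s3 [fr3 red]; apply: runs_skip; rewrite /prune /low_degree vS low; split=> //.
exact: frame_trans fr3.
Qed.

(** A nonempty [S] contains a vertex of degree at most 1. If nothing is removed before its visit, it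
    is removed itself, so every round shrinks a nonempty [S]. *)
Lemma round_runs S tab acc s :
  acyclic T -> represents S tab acc s ->
  runs round s (n * (n * 40 + 520) + 10) (fun s' => reg s' 7 = reg s 7 /\
    exists S' tab' acc', [/\ represents S' tab' acc' s',
      forall k, attainable T S tab acc k <-> attainable T S' tab' acc' k &
      #|S'| <= #|S|.-1]).
Proof.
(* The last clause: as long as [S] is intact, some vertex of low degree is still to be visited. *)
move=> acT rep; pose I i s' := [/\ reg s' 7 = reg s 7, reg s' 8 = i,
  reg s' 9 = i * n & exists S' tab' acc', [/\ represents S' tab' acc' s',
    forall k, attainable T S tab acc k <-> attainable T S' tab' acc' k,
    S' \subset S &
    S' = S -> S != set0 -> exists2 w : 'I_n, w \in S & (i <= w) && low_degree S w]].
apply: (@runs_seq_le _ _ _ _ 2); first lia; apply: runs_assign.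
apply: (@runs_seq_le _ _ _ _ 2); first lia; apply: runs_assign.
set s1 := set_reg _ _ _.
apply: (@runs_seq_le _ _ _ _ (n * ((n * 40 + 504) + 8) + 4)); first lia.
have I0 : I 0 s1.
  split=> //; exists S, tab, acc; split=> //.
    by do 2!(apply: represents_set_reg => //).
  by move=> _ /(acyclic_low_degree acT)[w wS lw]; exists w.
apply: runs_weaken (runs_for _ _ I0) (leqnn _) _.
- move=> i s' [_ r8 _ [S' [tab' [acc' [[[r0 _ _] _] _ _ _]]]]]; exact: conj r0 r8.
- move=> i s' lt_in [r7 r8 r9 [S' [tab' [acc' [rep' eqv sub low]]]]].
  pose v := Ordinal lt_in.
  apply: (@runs_seq_le _ _ _ _ (n * 40 + 500)); first lia.
  apply: runs_weaken (visit_runs (v := v) rep' r8 r9) (leqnn _) _.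
  move=> s2 [fr [tab2 [acc2 [rep2 eqv2]]]].
  have [[r0 _ _] _] := rep2.
  apply: (@runs_le _ _ 4); last by lia.
  apply: runs_assign; split; first by rewrite /set_reg /upd /= fr.
  split; [by rewrite /set_reg /upd /= fr|by []| |].
    by rewrite /set_reg /upd /= fr // r9 r0 mulSn addnC.
  exists (prune S' v), tab2, acc2; split.
  + by do 2!(apply: represents_set_reg => //).
  + by move=> k; rewrite eqv eqv2.
  + by rewrite /prune; case: ifP => // _; rewrite (subset_trans (subsetDl _ _)).
  (* Had [w] been the vertex just visited, [prune] would have removed it; so its index exceeds
     [i]. *)
  + move=> pS S0; have subv : prune S' v \subset S'.
      by rewrite /prune; case: ifP => // _; apply: subsetDl.
    have SS : S' = S by apply/eqP; rewrite eqEsubset sub -pS.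
    have [//|//|w wS /andP[iw lw]] := low; exists w => //; rewrite lw andbT ltn_neqAle iw andbT.
    apply/eqP=> vw; have {}vw : v = w by apply: val_inj.
    have := in_setD1 v S v; rewrite eqxx /=; move: pS; rewrite SS /prune vw wS lw /= => ->.
    by rewrite wS.
- move=> s' [r7 r8 _ [S' [tab' [acc' [rep' eqv sub low]]]]].
  apply: (@runs_le _ _ 1); last by lia.
  apply: runs_skip; split=> //; exists S', tab', acc'; split=> //.
  have [S0|S0] := eqVneq S set0.
    by move: sub; rewrite S0 subset0 => /eqP->; rewrite cards0.
  have : S' \proper S.
    rewrite properEneq sub andbT; apply/eqP=> SS.
    by have [//|//|w _ /andP[]] := low; rewrite leqNgt ltn_ord.
  by move/proper_card; lia.
Qed.

Lemma square_runs :
  runs square (input G) (n * 12 + 4) (fun s => [/\ memory s = memory (input G),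
    reg s 0 = n, reg s 1 = n * n & reg s 13 = 0]).
Proof.
pose I i s := [/\ memory s = memory (input G), reg s 0 = n,
  reg s 1 = i * n & reg s 13 = 0] /\ reg s 7 = i.
apply: runs_weaken (@runs_for 7 _ n 4 I _ _ _ _) _ _ => //.
- by move=> i s [[_ r0 _ _] r7].
- move=> i s lt_in [[E r0 r1 r13] r7]; apply: runs_assign.
  by split=> //; split=> //; split=> //=; rewrite /upd /= r0 r1 mulSn addnC.
- by move=> s [].
Qed.

(** Rows from n on lie beyond the matrix and hold zeros: no vertex is marked, and all tables
    vanish. *)
Lemma rows_runs s :
  memory s = memory (input G) -> reg s 0 = n -> reg s 1 = n * n -> reg s 13 = 0 ->
  runs rows s 21 (represents setT (fun _ _ => 0) 0).
Proof.
move=> E r0 r1 r13; have high i v : n <= i -> memory (input G) (i * n + v) = 0.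
  move=> ni; rewrite /=; case: existsP => // -[a /existsP[b /andP[_]]].
  by rewrite addr_eq => /andP[/eqP ia _]; rewrite ia leqNgt ltn_ord in ni.
do 5!(apply: (@runs_seq_le _ _ _ _ 4) => //; apply: runs_assign).
apply: runs_skip; split; split; rewrite /set_reg /upd //=.
- by do 6?[case=> [_|]] => //= *; rewrite ?r0 ?r1 mulnDl; lia.
- rewrite E => v w /=; congr nat_of_bool; apply/existsP/idP=> [[a /existsP[b]]|Gvw].
    by rewrite addr_eq => /andP[Gab /andP[/eqP/val_inj-> /eqP->]].
  by exists v; apply/existsP; exists w; rewrite Gvw eqxx.
- by move=> v; rewrite E high ?leq_addr // inE.
- by move=> x v; rewrite E high ?leq_addr.
Qed.

Lemma start_cells_runs s :
  represents setT (fun _ _ => 0) 0 s -> reg s 8 = 0 ->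
  runs start_cells s (n * 38 + 4) (represents setT (@start_table 'I_n) 0).
Proof.
move=> rep r8.
pose tab i x (w : 'I_n) := if w < i then start_table x w else 0.
pose I i s' := represents setT (tab i) 0 s' /\ reg s' 8 = i.
apply: runs_weaken (@runs_for 8 _ n 30 I _ _ _ _) _ _ => //.
- by move=> i s' [[[r0 _ _] _] r8'].
- move=> i s' lt_in [rep' r8']; pose v := Ordinal lt_in.
  have [[r0 _ _] _] := rep'.
  apply: (@runs_seq_le _ _ _ _ 7) => //.
  apply: (set_table_cell_runs (v := v) rep' r8') => s1 rep1 E1.
  apply: (@runs_seq_le _ _ _ _ 5) => //.
  apply: (set_table_cell_runs (v := v) rep1); rewrite ?E1 // => s2 rep2 E2.
  apply: (@runs_seq_le _ _ _ _ 7) => //.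
  apply: (set_table_cell_runs (v := v) rep2); rewrite ?E2 ?E1 // => s3 rep3 E3.
  apply: (@runs_le _ _ 1) => //; apply: runs_skip.
  split; first by rewrite E3.
  split=> //; apply: represents_set_reg => //.
  apply: represents_table rep3 _ => x w.
  have ltw : (w < i.+1) = (w == v) || (w < i) by rewrite ltnS leq_eqVlt.
  rewrite /set_table /tab ltw /= E2 r0; have [->|_] := eqVneq w v; last by rewrite !andbF.
  by rewrite /= ltnn; case: x => [|[]|[]]; rewrite //= card_ord addn1.
- move=> s' [rep' _]; apply: represents_table rep' _ => x w.
  by rewrite /tab ltn_ord.
Qed.

(** Each round removes a vertex while one is left, so after n rounds [S] is empty and register 13
    holds the optimum. *)
Lemma cotree_chi_b_runs :
  acyclic T ->
  runs cotree_chi_b (input G) (n * (n * (n * 40 + 520) + 100) + 100)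
    (fun s => reg s 0 = chi_b G).
Proof.
move=> acT.
apply: (@runs_seq_le _ _ _ _ (n * 12 + 4)); first by nia.
apply: runs_weaken square_runs (leqnn _) _ => s1 [E1 r0 r1 r13].
apply: (@runs_seq_le _ _ _ _ 21); first by nia.
apply: runs_weaken (rows_runs E1 r0 r1 r13) (leqnn _) _ => s2 rep2.
apply: (@runs_seq_le _ _ _ _ 2); first by nia.
apply: runs_assign.
apply: (@runs_seq_le _ _ _ _ (n * 38 + 4)); first by nia.
apply: runs_weaken (start_cells_runs _ _) (leqnn _) _ => //.
  exact: represents_set_reg.
move=> s3 rep3.
apply: (@runs_seq_le _ _ _ _ 2); first by nia.
apply: runs_assign.
pose I i s := reg s 7 = i /\ exists S tab acc, [/\ represents S tab acc s,
  forall k, attainable T setT (@start_table 'I_n) 0 k <-> attainable T S tab acc k &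
  #|S| <= n - i].
apply: (@runs_seq_le _ _ _ _ (n * ((n * (n * 40 + 520) + 10) + 8) + 4)); first by nia.
have I0 : I 0 (set_reg s3 7 0).
  split=> //; exists setT, (@start_table 'I_n), 0; split=> //.
    exact: represents_set_reg.
  by rewrite cardsT card_ord subn0.
apply: runs_weaken (runs_for _ _ I0) (leqnn _) _.
- by move=> i s [r7 [S [tab [acc [[[r0' _ _] _] _ _]]]]].
- move=> i s lt_in [r7 [S [tab [acc [rep eqv card]]]]].
  apply: runs_weaken (round_runs acT rep) (leqnn _) _.
  move=> s' [r7' [S' [tab' [acc' [rep' eqv' card']]]]].
  split; first by rewrite r7' r7.
  split=> //; exists S', tab', acc'; split; last by lia.
    exact: represents_set_reg.
  by move=> k; rewrite eqv eqv'.
- move=> s [_ [S [tab [acc [rep eqv]]]]]; rewrite subnn leqn0 cards_eq0 => /eqP S0.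
  apply: (@runs_le _ _ (4 + 1)); last by nia.
  apply: runs_seq; apply: runs_assign; apply: runs_skip.
  have [[r0' _ r13'] _] := rep; rewrite /set_reg /upd /= r0' r13'.
  rewrite (@chi_b_attainable _ _ acT acc) ?card_ord // => k.
  by rewrite eqv S0 attainable_set0.
Qed.

End Correctness.

Theorem theorem9 :
  exists c : cmd,
    polytime_computes (fun n (G : sgraph 'I_n) => is_cotree G)
                      (fun n (G : sgraph 'I_n) => chi_b G) c.
Proof.
exists cotree_chi_b,
  ('X * ('X * ('X * 40%N%:P + 520%N%:P) + 100%N%:P) + 100%N%:P)%R.
move=> n G [_ acT]; have [t [s [ex le chi]]] := cotree_chi_b_runs acT.
exists t, s; split; [exact: ex | | exact: chi].
rewrite !hornerE.
exact: le.
Qed.
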